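(* Let $G$ be a locally compact group, and $V$ a Banach space. (1) Suppose that $G$ has two non-compact closed normal subgroups centralizing each other. Then $G$ has Property $(\mathrm{BP}_0^V)$. (2) Suppose that $G$ has a non-compact closed normal subgroup with Property $(\mathrm{BP}_0^V)$. Then $G$ has Property $(\mathrm{BP}_0^V)$.
   Context: An isometric linear representation $\pi$ of a locally compact group $G$ on a Banach space $V$ is $C_0$ if for every $L\in V^*$ (topological dual) and every $v\in V$ one has $L(\pi(g)v)\to 0$ as $g\to\infty$ in $G$. An affine isometric action of $G$ on $V$ with linear part $\pi$ is a (continuous) action of the form $\alpha(g)v=\pi(g)v+b(g)$. It is proper if for some (equivalently every) $v\in V$ one has $\|\alpha(g)v\|\to\infty$ as $g\to\infty$. A locally compact group $G$ has Property $(\mathrm{BP}_0^V)$ if, for every $C_0$ isometric linear representation $\pi$ of $G$ on $V$, any affine isometric action of $G$ on $V$ with linear part $\pi$ either has a bounded orbit or is proper. *)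

(* Defs.v *)
From HB Require Import structures.
From mathcomp Require Import all_boot all_order all_algebra.
From mathcomp Require Import all_classical all_reals all_analysis.
From mathcomp.real_closed Require Import complex.

Set Implicit Arguments.
Unset Strict Implicit.
Unset Printing Implicit Defensive.

Import Order.TTheory GRing.Theory Num.Theory.
Import numFieldNormedType.Exports.

Local Open Scope classical_set_scope.
Local Open Scope ring_scope.

HB.mixin Record Group_isTopologicalGroup G & Topological G & Group G := {
  mulg_continuous : continuous (fun x : G * G => (x.1 * x.2)%g) ;
  invg_continuous : continuous (fun x : G => x^-1%g) ;
}.

#[short(type="topologicalGroupType")]
HB.structure Definition TopologicalGroup :=
  {G of Topological G & Group G & Group_isTopologicalGroup G}.

(* Local compactness includes the Hausdorff axiom, as is usual for groups. *)
Definition locally_compact_group (G : topologicalGroupType) : Prop :=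
  hausdorff_space G /\ locally_compact [set: G].

Record subgroup (G : groupType) := Subgroup {
  subgroup_set :> set G ;
  subgroup_closed : group_closed [pred x | x \in subgroup_set] }.

HB.instance Definition _ (G : groupType) (N : subgroup G) :=
  SubChoice.copy (set_type (subgroup_set N)) {x : G | x \in subgroup_set N}.

(* The topology of [set_type N] is the library's subspace topology. *)
HB.instance Definition _ (G : groupType) (N : subgroup G) :=
  SubChoice_isSubGroup.Build G (fun x => x \in subgroup_set N)
    (set_type (subgroup_set N)) (subgroup_closed N).

Section subgroup_topology.
Variables (G : topologicalGroupType) (N : subgroup G).

Lemma subgroup_mulg_continuous :
  continuous (fun x : set_type N * set_type N => (x.1 * x.2)%g).
Proof.
apply: continuous_comp_initial => x.
apply: (@continuous_comp _ (G * G)%type _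
  (fun y : set_type N * set_type N => (set_val y.1, set_val y.2))
  (fun z => (z.1 * z.2)%g)); last exact: mulg_continuous.
apply: cvg_pair => /=.
  apply: (@continuous_comp _ _ _ fst (set_val : set_type N -> G)).
    exact: cvg_fst.
  exact: initial_continuous.
apply: (@continuous_comp _ _ _ snd (set_val : set_type N -> G)).
  exact: cvg_snd.
exact: initial_continuous.
Qed.

Lemma subgroup_invg_continuous : continuous (fun x : set_type N => x^-1%g).
Proof.
apply: continuous_comp_initial => x.
apply: (@continuous_comp _ G _ set_val (fun z : G => z^-1%g)).
  exact: initial_continuous.
exact: invg_continuous.
Qed.

HB.instance Definition _ := Group_isTopologicalGroup.Build
  (set_type (subgroup_set N)) subgroup_mulg_continuous subgroup_invg_continuous.

End subgroup_topology.

Definition normal_subgroup (G : groupType) (N : subgroup G) : Prop :=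
  forall g x : G, subgroup_set N x -> subgroup_set N (x ^ g)%g.

Definition centralize_each_other (G : groupType) (M N : subgroup G) : Prop :=
  forall x y : G, subgroup_set M x -> subgroup_set N y -> commute x y.

Definition at_infinity (T : topologicalType) : set_system T :=
  filter_from compact (fun C => ~` C).
Arguments at_infinity : clear implicits.

(* Banach spaces are taken over the reals or the complex numbers. *)
Variant scalar_kind := RealScalars | ComplexScalars.

Definition scalars (R : realType) (k : scalar_kind) : numFieldType :=
  match k with
  | RealScalars => R
  | ComplexScalars => R[i]
  end.

Definition is_group_action (G : groupType) (X : Type) (act : G -> X -> X) :=
  (forall x, act 1%g x = x) /\
  (forall g h x, act (g * h)%g x = act g (act h x)).

Section banach_actions.
Variables (K : numFieldType) (G : topologicalGroupType).
Variable V : completeNormedModType K.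

Definition isometric_representation (pi : G -> {linear V -> V}) : Prop :=
  [/\ is_group_action (fun g v => pi g v),
      forall g v, `|pi g v| = `|v| &
      forall v, continuous (fun g => pi g v)].

Definition C0_representation (pi : G -> {linear V -> V}) : Prop :=
  forall L : {linear V -> K^o}, continuous L ->
  forall v : V, L (pi g v) @[g --> at_infinity G] --> (0 : K^o).

(* Such an action is isometric as soon as [pi] is. *)
Definition affine_action (pi : G -> {linear V -> V}) (alpha : G -> V -> V) :
    Prop :=
  [/\ is_group_action alpha,
      continuous (fun z : G * V => alpha z.1 z.2) &
      exists b : G -> V, forall g v, alpha g v = pi g v + b g].

Definition has_bounded_orbit (alpha : G -> V -> V) : Prop :=
  exists v : V, bounded_set (range (fun g => alpha g v)).

(* [+oo] is the filter generated by the sets of the scalars exceeding a given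
   real scalar, so that it also makes sense when [K] is complex. *)
Definition proper_action (alpha : G -> V -> V) : Prop :=
  exists v : V, `|alpha g v| @[g --> at_infinity G] --> +oo.

Definition property_BP0 : Prop :=
  forall pi : G -> {linear V -> V},
    isometric_representation pi -> C0_representation pi ->
  forall alpha : G -> V -> V, affine_action pi alpha ->
    has_bounded_orbit alpha \/ proper_action alpha.

End banach_actions.

(* Main.v *)
From HB Require Import structures.
Require Import Defs.
From mathcomp Require Import all_boot all_order all_algebra.
From mathcomp Require Import all_classical all_reals all_analysis.
From mathcomp.real_closed Require Import complex.
From mathcomp Require Import ring.
Local Open Scope classical_set_scope.

(** Fix an affine isometric action of G with C_0 linear part pi and let
b(g) = alpha(g) 0. Then b(gh) = b(g) + pi(g) b(h), orbits are bounded iff b is,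
and the action is proper iff |b| tends to infinity ([has_bounded_orbitP],
[proper_actionP]). Evaluating b on hg = g h^g in both ways gives

  b(h) - pi(g) b(h^g) = b(g) - pi(h) b(g)                  ([cocycle_conjg])

and the whole proof consists in letting g or h go to infinity in this equality.
The norm of a weak limit is at most any bound of the norms
([norm_le_weak_limit]), by the Hahn-Banach theorem, and the C_0 hypothesis makes
one of the terms vanish weakly. Let N be a normal, closed, non-compact subgroup.

- If |b| <= r on N, fix g and let h go to infinity in N: the left-hand side has
  norm at most 2r and the right-hand side tends weakly to b(g). Hence |b| <= 2r
  on G ([bounded_of_bounded_along]).

- If g goes to infinity with |b(g)| <= r, while b(h^g) stays in a compact set,
  then pi(g) b(h^g) tends weakly to 0 ([C0_cvg_compact]), so that |b(h)| <= 2r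
  ([norm_cocycle_le]).

The second item is used twice. Suppose first that |b| tends to infinity along N
but not on G, and let g go to infinity with |b(g)| <= r. For h in N, the
equality bounds |b(h^g)| by 2r + |b(h)|; as h^g is in N, it stays in a compact
set. So |b| <= 2r on N, which contradicts the properness along the non-compact
N. Properness along N thus implies properness ([proper_of_proper_along]). With
the first item, this transfers the dichotomy from N to G, which is assertion
(2). Suppose next that M and N centralize each other and that b is not proper
along M. Let g go to infinity in M with |b(g)| <= r: as h^g = h for h in N, the
cocycle b is bounded on N ([bounded_along_of_commute]), hence on G by the first
item. If it is proper along M, then it is proper on G; this is assertion (1).

The Hahn-Banach theorem is proved from the fact that a sublinear functional
which is minimal for the pointwise order is linear. *)

Set Implicit Arguments.
Unset Strict Implicit.
Unset Printing Implicit Defensive.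
Import Order.TTheory GRing.Theory Num.Theory.
Import numFieldNormedType.Exports.
Local Open Scope ring_scope.

(** * The Hahn-Banach theorem *)

Section SublinearFunctionals.
Variables (R : realType) (K : numFieldType) (iota : {rmorphism R -> K}).
Variable V : lmodType K.
Implicit Types (p : V -> R) (x y v : V).

(** The real scalars act through a morphism [iota], so that real and complex
spaces are treated alike, without putting a second module structure on [V].
Only one half of positive homogeneity is required: the other half follows by
scaling back ([sublinearZ]). *)
Definition sublinear p :=
  (forall x y, p (x + y) <= p x + p y) /\
  (forall a x, 0 <= a -> p (iota a *: x) <= a * p x).

Lemma sublinear0 p : sublinear p -> p 0 = 0.
Proof.
move=> [pD pZ]; apply/eqP; rewrite eq_le; apply/andP; split.
  by have := pZ 0 0 (lexx _); rewrite scaler0 mul0r.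
by have := pD 0 0; rewrite addr0 lerDl.
Qed.

Lemma sublinear_oppr_le p x : sublinear p -> - p (- x) <= p x.
Proof.
move=> sp; have := sp.1 x (- x).
by rewrite subrr sublinear0// -lerBlDr sub0r.
Qed.

Lemma sublinearZ p a x : sublinear p -> 0 <= a -> p (iota a *: x) = a * p x.
Proof.
move=> sp; rewrite le_eqVlt => /predU1P[<-|a_gt0].
  by rewrite rmorph0 scale0r mul0r sublinear0.
apply/eqP; rewrite eq_le sp.2 ?(ltW a_gt0)//=.
rewrite -ler_pdivlMl//.
have := sp.2 a^-1 (iota a *: x).
rewrite invr_ge0 ltW// => /(_ isT).
by rewrite scalerA -rmorphM mulVf ?gt_eqF// rmorph1 scale1r.
Qed.

(** Infima of sublinear functionals are not sublinear in general; what is needed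
is a form of directedness of the family, which the chains of Zorn's lemma and
the family defining [tilt] both have. *)
Lemma sublinear_inf (I : Type) (D : set I) (q : I -> V -> R) :
  D !=set0 ->
  (forall x, has_lbound [set q i x | i in D]) ->
  (forall i j x y, D i -> D j ->
    exists2 k, D k & q k (x + y) <= q i x + q j y) ->
  (forall i a x, D i -> 0 <= a ->
    exists2 k, D k & q k (iota a *: x) <= a * q i x) ->
  sublinear (fun x => inf [set q i x | i in D]).
Proof.
move=> [i0 Di0] qlb qD qZ.
have inf_leq i x : D i -> inf [set q j x | j in D] <= q i x.
  by move=> Di; apply: ge_inf => //; exists i.
have leq_inf x r : (forall i, D i -> r <= q i x) ->
    r <= inf [set q j x | j in D].
  move=> rq; apply: lb_le_inf; first by exists (q i0 x), i0.
  by move=> _ [i Di <-]; exact: rq.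
split=> [x y|a x].
  rewrite -lerBlDr; apply: (leq_inf _) => i Di.
  rewrite lerBlDr -lerBlDl; apply: (leq_inf _) => j Dj.
  rewrite lerBlDl; have [k Dk kij] := qD i j x y Di Dj.
  exact: le_trans (inf_leq _ _ Dk) kij.
rewrite le_eqVlt => /predU1P[<-|a_gt0].
  have [k Dk kx] := qZ i0 0 x Di0 (lexx 0); rewrite mul0r in kx; rewrite mul0r.
  exact: le_trans (inf_leq _ _ Dk) kx.
rewrite mulrC -ler_pdivrMr//; apply: (leq_inf _) => i Di.
rewrite ler_pdivrMr// mulrC; have [k Dk kx] := qZ i a x Di (ltW a_gt0).
exact: le_trans (inf_leq _ _ Dk) kx.
Qed.

(** The largest sublinear functional [q <= p] such that [q (- v) <= - p v],
that is, which is linear in the direction [v] with value [p v]. *)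
Definition tilt p v x : R :=
  inf [set p (x + iota t *: v) - t * p v | t in [set t | 0 <= t]].

Lemma tilt_lbound p v x : sublinear p ->
  has_lbound [set p (x + iota t *: v) - t * p v | t in [set t | 0 <= t]].
Proof.
move=> sp; exists (- p (- x)) => _ [t /= t0 <-].
rewrite -(sublinearZ v sp t0) lerBrDr addrC -lerBrDr opprK.
by have := sp.1 (x + iota t *: v) (- x); rewrite addrC addKr.
Qed.

Lemma tilt_le p v x t : sublinear p -> 0 <= t ->
  tilt p v x <= p (x + iota t *: v) - t * p v.
Proof. by move=> sp t0; apply: ge_inf; [exact: tilt_lbound|exists t]. Qed.

Lemma tilt_le_self p v x : sublinear p -> tilt p v x <= p x.
Proof.
move=> sp; have := tilt_le v x sp (lexx 0).
by rewrite rmorph0 scale0r addr0 mul0r subr0.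
Qed.

Lemma tilt_oppr p v : sublinear p -> tilt p v (- v) <= - p v.
Proof.
move=> sp; have := tilt_le v (- v) sp ler01.
by rewrite rmorph1 scale1r addNr sublinear0// mul1r sub0r.
Qed.

Lemma sublinear_tilt p v : sublinear p -> sublinear (tilt p v).
Proof.
move=> sp; apply: sublinear_inf.
- by exists 0 => /=.
- by move=> x; exact: tilt_lbound.
- move=> s t x y /= s0 t0; exists (s + t) => /=; first exact: addr_ge0.
  rewrite rmorphD/= scalerDl addrACA mulrDl opprD [leRHS]addrACA lerD2r.
  exact: sp.1.
- move=> t a x /= t0 a0; exists (a * t) => /=; first exact: mulr_ge0.
  rewrite rmorphM/= -scalerA -scalerDr mulrBr mulrA lerD2r.
  exact: sp.2.
Qed.

(** Minimality forces [tilt p v = p] for every [v], hence [p (- v) = - p v]: an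
odd sublinear functional is linear. *)
Lemma minimal_sublinear_linear p : sublinear p ->
  (forall q, sublinear q -> (forall x, q x <= p x) -> q = p) ->
  (forall x y, p (x + y) = p x + p y) /\
  (forall a x, p (iota a *: x) = a * p x).
Proof.
move=> sp pmin.
have pN v : p (- v) = - p v.
  apply/eqP; rewrite eq_le; apply/andP; split.
    rewrite -{1}(pmin _ (sublinear_tilt v sp)); first exact: tilt_oppr.
    by move=> x; exact: tilt_le_self.
  by rewrite lerNl sublinear_oppr_le.
split=> [x y|a x].
  apply/eqP; rewrite eq_le sp.1/= -lerBrDr -pN.
  by have := sp.1 (x + y) (- y); rewrite addrK.
have [a0|a0] := leP 0 a; first exact: sublinearZ.
rewrite -[a]opprK rmorphN/= scaleNr pN sublinearZ ?oppr_ge0 ?ltW//.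
by rewrite !mulNr.
Qed.

(** By Zorn's lemma: on a nonempty chain the pointwise infimum is finite,
because every sublinear [p <= p0] satisfies [- p0 (- x) <= p x]. *)
Lemma exists_minimal_sublinear p0 : sublinear p0 ->
  exists p, [/\ sublinear p, forall x, p x <= p0 x &
    forall q, sublinear q -> (forall x, q x <= p x) -> q = p].
Proof.
move=> sp0; pose T := {p | sublinear p /\ forall x, p x <= p0 x}.
pose ge_fun (s t : T) := `[< forall x, sval t x <= sval s x >].
suff [[p [sp pp0]] pmin] : exists p : T, forall q : T, ge_fun p q -> q = p.
  exists p; split=> // q sq qp.
  have qp0 x : q x <= p0 x by exact: le_trans (qp x) (pp0 x).
  by apply: (congr1 sval (pmin (exist _ q (conj sq qp0)) _)); exact/asboolP.
apply: Zorn.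
- by move=> t; apply/asboolP.
- move=> r s t /asboolP rs /asboolP st; apply/asboolP => x.
  exact: le_trans (st x) (rs x).
- move=> [s sP] [t tP] /asboolP/= st /asboolP/= ts; apply: eq_exist => /=.
  by apply/funext => x; apply/eqP; rewrite eq_le ts st.
- move=> A chainA; have [[s0 As0]|A0] := pselect (A !=set0); last first.
    exists (exist _ p0 (conj sp0 (fun=> lexx _))) => s As.
    by case: A0; exists s.
  have Albound x : has_lbound [set sval s x | s in A].
    exists (- p0 (- x)) => _ [s As <-].
    apply: le_trans (sublinear_oppr_le _ (svalP s).1).
    by rewrite lerN2; apply: (svalP s).2.
  have inf_le s x : A s -> inf [set sval t x | t in A] <= sval s x.
    by move=> As; apply: ge_inf => //; exists s.
  have sinf : sublinear (fun x => inf [set sval s x | s in A]).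
    apply: sublinear_inf => //; first by exists s0.
    - move=> s t x y As At.
      have [/asboolP st|/asboolP ts] := chainA _ _ As At.
        exists t => //; apply: le_trans ((svalP t).1.1 _ _) _.
        by rewrite lerD2r.
      exists s => //; apply: le_trans ((svalP s).1.1 _ _) _.
      by rewrite lerD2l.
    - by move=> s a x As a0; exists s => //; exact: (svalP s).1.2.
  have infp0 x : inf [set sval s x | s in A] <= p0 x.
    exact: le_trans (inf_le _ _ As0) ((svalP s0).2 x).
  pose t : T :=
    exist _ (fun x => inf [set sval s x | s in A]) (conj sinf infp0).
  by exists t => s As; apply/asboolP => x; exact: inf_le.
Qed.

(** A minimal sublinear functional below [tilt p v] is linear; its value at
[- v] is at most [- p v], so that its value at [v] is [p v]. *)
Lemma sublinear_Hahn_Banach p v : sublinear p ->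
  exists f : V -> R, [/\ forall x y, f (x + y) = f x + f y,
    forall a x, f (iota a *: x) = a * f x,
    forall x, f x <= p x & f v = p v].
Proof.
move=> sp; have st := sublinear_tilt v sp.
have [f [sf ft fmin]] := exists_minimal_sublinear st.
have [fD fZ] := minimal_sublinear_linear sf fmin.
have fp x : f x <= p x := le_trans (ft x) (tilt_le_self v x sp).
exists f; split=> //; apply/eqP; rewrite eq_le fp/= -lerN2.
have fN : f (- v) = - f v.
  by have := fZ (-1) v; rewrite rmorphN rmorph1 scaleN1r mulN1r.
by rewrite -fN; exact: le_trans (ft _) (tilt_oppr v sp).
Qed.

End SublinearFunctionals.

(** * Norming functionals *)

Lemma contracting_linear_functional (K : numFieldType) (V : normedModType K)
    (f : V -> K) :
  (forall x y, f (x + y) = f x + f y) -> (forall a x, f (a *: x) = a * f x) ->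
  (forall x, `|f x| <= `|x|) ->
  exists L : {linear V -> K^o}, continuous L /\ (forall x, L x = f x).
Proof.
move=> fD fZ fle.
have flin : linear_for *:%R (f : V -> K^o) by move=> a x y; rewrite fD fZ.
pose L : {linear V -> K^o} :=
  HB.pack (f : V -> K^o) (GRing.isLinear.Build K V K^o *:%R f flin).
exists L; split=> // x; apply/cvgrPdist_lt => e e0.
near=> y; rewrite -linearB; apply: le_lt_trans (fle _) _.
by near: y; move: e e0; exact/cvgrPdist_lt.
Unshelve. all: by end_near. Qed.

Lemma norming_functional_real (R : realType) (V : normedModType R) (v : V) :
  exists L : {linear V -> R^o},
    [/\ continuous L, forall x, `|L x| <= `|x| & `|L v| = `|v|].
Proof.
have sp : sublinear (idfun : {rmorphism R -> R}) (fun x : V => `|x|).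
  split=> [x y|a x a0]; first exact: ler_normD.
  by rewrite normrZ ger0_norm.
have [f [fD fZ fle fv]] := sublinear_Hahn_Banach v sp.
have fN x : f (- x) = - f x.
  by have := fZ (-1) x; rewrite /= scaleN1r mulN1r.
have fabs x : `|f x| <= `|x|.
  by rewrite ler_norml fle andbT lerNl -fN -[leRHS]normrN fle.
have [L [Lcont LE]] := contracting_linear_functional fD fZ fabs.
exists L; split=> // [x|]; first by rewrite LE.
by rewrite LE fv normr_id.
Qed.

(** A complex functional is recovered from its real part [f] as
[f x - i f (i x)]. Multiplying [x] by a phase which makes the value at [x] real
turns the bound on [f] into the same bound on the modulus. *)
Lemma norming_functional_complex (R : realType) (V : normedModType R[i])
    (v : V) :
  exists L : {linear V -> R[i]^o},
    [/\ continuous L, forall x, `|L x| <= `|x| & `|L v| = `|v|].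
Proof.
pose N (x : V) : R := complex.Re `|x|.
have NE x : `|x| = (N x)%:C%C.
  have := normr_ge0 x; rewrite /N.
  by case: `|x| => a b /=; rewrite lecE /= => /andP[/eqP -> _].
have sp : sublinear (real_complex R : {rmorphism R -> R[i]}) N.
  split=> [x y|a x a0].
    by have := ler_normD x y; rewrite !NE -rmorphD lecR.
  have := normrZ (real_complex R a) x; rewrite !NE.
  rewrite ger0_norm ?lecR// -rmorphM => /complexI ->.
  exact: lexx.
have [f [fD fZ fle fv]] := sublinear_Hahn_Banach v sp.
pose g (x : V) : R[i] := (f x +i* (- f ('i%C *: x)))%C.
have gD x y : g (x + y) = g x + g y.
  by rewrite /g scalerDr !fD opprD.
have gZ a x : g (a *: x) = a * g x.
  have fc (b c : R) y : f ((b +i* c)%C *: y) = b * f y + c * f ('i%C *: y).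
    rewrite [(b +i* c)%C]complexE/= scalerDl fD fZ; congr (_ + _).
    by rewrite -fZ scalerA mulrC.
  case: a => b c; rewrite /g scalerA.
  have -> : 'i%C * (b +i* c)%C = ((- c) +i* b)%C :> R[i].
    by apply/eqP; rewrite eq_complex /=; apply/andP; split; apply/eqP; ring.
  rewrite (fc b c) (fc (- c) b); apply/eqP; rewrite eq_complex /=.
  by apply/andP; split; apply/eqP; ring.
have fRe x : f x = complex.Re (g x) by [].
have gabs x : `|g x| <= `|x|.
  have [->|gx0] := eqVneq (g x) 0; first by rewrite normr0.
  (* The phase [u] turns [g x] into its modulus. *)
  pose u := `|g x| / g x.
  have un : `|u| = 1.
    by rewrite normrM normfV normr_id divff// normr_eq0.
  have ug : g (u *: x) = `|g x| by rewrite gZ divfK.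
  have := fle (u *: x); rewrite fRe ug -lecR -NE normrZ un mul1r.
  by rewrite normc_def.
have [L [Lcont LE]] := contracting_linear_functional gD gZ gabs.
exists L; split=> // [x|]; first by rewrite LE.
apply/eqP; rewrite eq_le; apply/andP; split; first by rewrite LE.
rewrite LE NE -fv fRe; apply: le_trans (normc_ge_Re _).
rewrite ger0_norm// -fRe fv.
by rewrite -lecR -NE normr_ge0.
Qed.

Lemma norming_functional (R : realType) (k : scalar_kind)
    (V : normedModType (scalars R k)) (v : V) :
  exists L : {linear V -> (scalars R k)^o},
    [/\ continuous L, forall x, `|L x| <= `|x| & `|L v| = `|v|].
Proof.
case: k V v => V v.
  exact: norming_functional_real.
exact: norming_functional_complex.
Qed.

(** * Filters at infinity and weak limits *)

#[local] Instance at_infinity_filter (T : topologicalType) :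
  Filter (at_infinity T).
Proof.
apply: filter_from_filter; first by exists set0; exact: compact0.
move=> C D cC cD; exists (C `|` D); first exact: compactU.
by rewrite setCU.
Qed.

(** A filter is proper when one can go to infinity along it: this is the form in
which non-compactness is used. *)
Lemma within_at_infinity_proper (T : topologicalType) (N : set T) :
  closed N -> ~ compact N -> ProperFilter (within N (at_infinity T)).
Proof.
move=> clN ncN; apply: Build_ProperFilter_ex => P [C cC CP].
apply: contrapT => noP; apply: ncN; apply: (subclosed_compact clN cC) => x Nx.
by apply: contrapT => Cx; apply: noP; exists x; exact: CP.
Qed.

(** When the norm does not tend to infinity, one can still go to the limit along
[F] while keeping the norm bounded. *)
Lemma not_cvg_pinftyP (K : numFieldType) (V : normedModType K) (T : Type)
    (F : set_system T) (FF : Filter F) (b : T -> V) :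
  ~ (`|b t| @[t --> F] --> +oo) ->
  exists r : K, ProperFilter (within [set t | `|b t| <= r] F).
Proof.
move=> ncvg; apply: contrapT => /forallNP noproper; apply: ncvg.
move=> P [r [rreal rP]]; have := noproper r.
apply: contra_notP => noP; apply: Build_ProperFilter_ex => Q FQ.
apply: contrapT => noQ; apply: noP.
change (F (fun t => P `|b t|)).
have {}FQ : F [set t | `|b t| <= r -> Q t] by [].
apply: filterS FQ => t Qt; apply: rP.
rewrite real_ltNge// ?normr_real//; apply/negP => btr.
by apply: noQ; exists t; exact: Qt.
Qed.

Section WeakLimits.
Variables (R : realType) (k : scalar_kind).
Local Notation K := (scalars R k).

(** Weak lower semicontinuity of the norm: test the weak limit against a
functional of norm at most one which attains the norm of [v]. *)
Lemma norm_le_weak_limit (V : normedModType K) (T : Type) (F : set_system T)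
    (PF : ProperFilter F) (u : T -> V) (v : V) (r : K) :
  (forall L : {linear V -> K^o}, continuous L ->
     L (u t) @[t --> F] --> (L v : K^o)) ->
  (\forall t \near F, `|u t| <= r) -> `|v| <= r.
Proof.
move=> uv ur; have [L [Lcont Lle <-]] := norming_functional v.
apply/ler_addgt0Pr => e e0.
have [t []] : exists t, `|L v - L (u t)| < e /\ `|u t| <= r.
  apply: (@filter_ex _ F); near=> t; split; near: t => //.
  exact: (cvgrPdist_lt _ _).1 (uv L Lcont) e e0.
move=> /ltW Lve utr; rewrite -(subrK (L (u t)) (L v)) addrC.
apply: le_trans (ler_normD _ _) _; apply: lerD => //.
exact: le_trans (Lle _) utr.
Unshelve. all: by end_near. Qed.

Variables (G : topologicalGroupType) (V : completeNormedModType K).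
Variables (pi : G -> {linear V -> V}).
Hypotheses (ipi : isometric_representation pi) (c0 : C0_representation pi).

(** The functionals [L \o pi g] are equicontinuous, since [pi] is isometric;
their pointwise convergence to [0] is therefore uniform on compact sets. *)
Lemma C0_cvg_compact (Q : set V) (w : G -> V) (F : set_system G)
    (FF : Filter F) (L : {linear V -> K^o}) :
  compact Q -> F `=>` at_infinity G -> (\forall g \near F, Q (w g)) ->
  continuous L -> L (pi g (w g)) @[g --> F] --> (0 : K^o).
Proof.
move=> cQ Finf Qw Lcont; apply/cvgr0Pnorm_lt => e e0.
have [_ isom _] := ipi.
have e20 : 0 < e / 2 by rewrite divr_gt0.
have [d /= d0 Ld] : exists2 d : K, 0 < d &
    forall z : V, `|z| < d -> `|L z| < e / 2.
  have /cvgrPdist_lt /(_ _ e20) : L x @[x --> (0 : V)] --> (L 0 : K^o).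
    exact: Lcont.
  move=> /nbhs_normP[d /= d0 dL]; exists d => // z zd.
  have := dL z; rewrite /ball_/= sub0r normrN linear0 sub0r normrN.
  exact.
have unif : \forall g \near at_infinity G,
    Q `<=` [set x | `|L (pi g x)| < e].
  apply: ((compact_near_coveringP _).1 cQ) => x Qx.
  have /cvgr0Pnorm_lt /(_ _ e20) Lx := c0 Lcont x.
  exists ([set y | `|x - y| < d], [set g | `|L (pi g x)| < e / 2]) => /=.
    split=> //; apply/nbhs_normP; exists d => //.
  move=> [y g] [/= yx gx].
  rewrite -(subrK x y) linearD linearD [e]splitr.
  apply: le_lt_trans (ler_normD _ _) _; apply: ltrD => //.
  by apply: Ld; rewrite isom distrC.
have {}unif := Finf _ unif.
by apply: filterS2 unif Qw => g; apply.
Qed.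

End WeakLimits.

(** * Cocycles of affine actions *)

Section AffineActions.
Variables (K : numFieldType) (G : topologicalGroupType).
Variables (V : completeNormedModType K) (pi : G -> {linear V -> V}).

Definition cocycle (b : G -> V) :=
  forall g h : G, b (g * h)%g = b g + pi g (b h).

Lemma affine_action_cocycle (alpha : G -> V -> V) :
  affine_action pi alpha ->
  exists b : G -> V,
    [/\ forall g v, alpha g v = pi g v + b g, cocycle b & continuous b].
Proof.
move=> [[_ alphaM] alphac [b alphaE]]; exists b.
have b0 g : alpha g 0 = b g by rewrite alphaE linear0 add0r.
split=> // [g h|g]; first by rewrite -!b0 alphaM alphaE addrC !b0.
have -> : b = (fun z : G * V => alpha z.1 z.2) \o (fun g => (g, 0)).
  by apply/funext => h /=; rewrite b0.
apply: continuous_comp; last exact: alphac.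
by apply: cvg_pair; [exact: cvg_id|exact: cvg_cst].
Qed.

Variables (alpha : G -> V -> V) (b : G -> V).
Hypotheses (ipi : isometric_representation pi)
  (alphaE : forall g v, alpha g v = pi g v + b g).

Lemma has_bounded_orbitP :
  has_bounded_orbit alpha <-> exists r : K, forall g, `|b g| <= r.
Proof.
have [_ isom _] := ipi; split=> [[v [M [Mreal Mb]]]|[r br]].
  have /Mb {}Mb : M < M + 1 by rewrite ltrDl.
  exists (M + 1 + `|v|) => g.
  have -> : b g = alpha g v - pi g v by rewrite alphaE addrC addKr.
  apply: le_trans (ler_normB _ _) _; rewrite isom lerD2r.
  by apply: Mb; exists g.
exists 0, r; split.
  by apply: ger0_real; exact: le_trans (normr_ge0 _) (br 1%g).
move=> M rM _ [g _ <-] /=; rewrite alphaE linear0 add0r.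
exact: le_trans (br g) (ltW rM).
Qed.

Lemma proper_actionP :
  proper_action alpha <-> `|b g| @[g --> at_infinity G] --> +oo.
Proof.
have [_ isom _] := ipi; split=> [[v alphav]|bp]; last first.
  by exists 0; under eq_fun do rewrite alphaE linear0 add0r.
move=> P [M [Mreal MP]].
have large : at_infinity G [set g | M + `|v| < `|alpha g v|].
  apply: (alphav [set x | M + `|v| < x]); exists (M + `|v|).
  by split=> //; rewrite realD// normr_real.
change (at_infinity G (fun g => P `|b g|)).
have FI := at_infinity_filter G.
apply: (@filterS _ _ FI) large => g /= Mg; apply: MP.
rewrite -(ltrD2r `|v|); apply: lt_le_trans Mg _.
rewrite alphaE addrC -(isom g v); exact: ler_normD.
Qed.

End AffineActions.

Section C0Cocycles.
Variables (R : realType) (k : scalar_kind).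
Local Notation K := (scalars R k).
Variables (G : topologicalGroupType) (V : completeNormedModType K).
Variables (pi : G -> {linear V -> V}) (b : G -> V).
Hypotheses (ipi : isometric_representation pi) (c0 : C0_representation pi).
Hypotheses (bcoc : cocycle pi b) (bcont : continuous b).

Definition proper_along (N : set G) :=
  `|b g| @[g --> within N (at_infinity G)] --> +oo.

(** Both sides come from [b (h * g) = b (g * h ^ g)]. *)
Lemma cocycle_conjg (g h : G) :
  b h - pi g (b (h ^ g)%g) = b g - pi h (b g).
Proof.
apply/eqP; rewrite subr_eq addrAC -subr_eq opprK; apply/eqP.
by rewrite -!bcoc conjgE !mulgA mulgV mul1g.
Qed.

Lemma norm_cocycle_conjg (g h : G) : `|b (h ^ g)%g| <= `|b g| *+ 2 + `|b h|.
Proof.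
have [_ isom _] := ipi; rewrite -(isom g).
have -> : pi g (b (h ^ g)%g) = b h - (b g - pi h (b g)).
  by rewrite -cocycle_conjg opprB addrC subrK.
apply: le_trans (ler_normB _ _) _; rewrite addrC lerD2r.
by apply: le_trans (ler_normB _ _) _; rewrite isom mulr2n.
Qed.

(** The left-hand side of [cocycle_conjg] tends weakly to [b h] along [F],
because [C0_cvg_compact] applies to the vectors [b (h ^ g)]; the right-hand side
has norm at most [r *+ 2]. *)
Lemma norm_cocycle_le (F : set_system G) (h : G) (Q : set V) (r : K) :
  ProperFilter F -> F `=>` at_infinity G -> compact Q ->
  (\forall g \near F, Q (b (h ^ g)%g)) -> (\forall g \near F, `|b g| <= r) ->
  `|b h| <= r *+ 2.
Proof.
move=> PF Finf cQ Qb br; have [_ isom _] := ipi.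
apply: (norm_le_weak_limit (u := fun g => b h - pi g (b (h ^ g)%g)) PF).
  move=> L Lcont; rewrite -[L (b h)]subr0.
  under eq_fun do rewrite linearB.
  apply: cvgB; first exact: cvg_cst.
  exact: (C0_cvg_compact (w := fun g => b (h ^ g)%g) ipi c0 _ cQ Finf Qb Lcont).
apply: filterS br => g br; rewrite cocycle_conjg.
apply: le_trans (ler_normB _ _) _.
by rewrite isom -mulr2n lerMn2r.
Qed.

(** In [cocycle_conjg], [h] goes to infinity in [N] and [g] is fixed: the
right-hand side tends weakly to [b g]. *)
Lemma bounded_of_bounded_along (N : set G) (r : K) :
  closed N -> ~ compact N -> (forall g h, N h -> N (h ^ g)%g) ->
  (forall h, N h -> `|b h| <= r) -> forall g, `|b g| <= r *+ 2.
Proof.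
move=> clN ncN normN br g; have [_ isom _] := ipi.
have PF := within_at_infinity_proper clN ncN.
apply: (norm_le_weak_limit (u := fun h => b g - pi h (b g)) PF).
  move=> L Lcont; rewrite -[L (b g)]subr0.
  under eq_fun do rewrite linearB.
  apply: cvgB; first exact: cvg_cst.
  apply: cvg_trans (c0 Lcont (b g)); apply: cvg_app; exact: cvg_within.
apply: (filterS _ (withinT _ _)) => h Nh; rewrite -cocycle_conjg.
apply: le_trans (ler_normB _ _) _; rewrite isom mulr2n.
by apply: lerD; apply: br => //; exact: normN.
Qed.

(** If [g] could go to infinity with [b g] bounded, then for [h] in [N] the
norms of [b (h ^ g)] would be bounded by [norm_cocycle_conjg], and properness
along [N] would confine [h ^ g] to a compact set. By [norm_cocycle_le], [b]
would be bounded on [N], which is impossible as [N] is not compact. *)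
Lemma proper_of_proper_along (N : set G) :
  closed N -> ~ compact N -> (forall g h, N h -> N (h ^ g)%g) ->
  proper_along N -> `|b g| @[g --> at_infinity G] --> +oo.
Proof.
move=> clN ncN normN propN; apply: contrapT => /not_cvg_pinftyP[r PF].
have r0 : 0 <= r.
  have [g gr] :=
    filter_ex (withinT [set g | `|b g| <= r] (at_infinity_filter G)).
  exact: le_trans gr.
have large (s : K) : s \is Num.real ->
    within N (at_infinity G) [set g | s < `|b g|].
  by move=> sreal; apply: (propN [set x | s < x]); exists s.
have [h [Nh rh]] : exists h, N h /\ r *+ 2 < `|b h|.
  have PN := within_at_infinity_proper clN ncN.
  have r2 : r *+ 2 \is Num.real by rewrite ger0_real// mulrn_wge0.
  have [h [Nh rh]] :=
    filter_ex (filterI (withinT N (at_infinity_filter G)) (large _ r2)).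
  by exists h.
have [C cC Clarge] : within N (at_infinity G)
    [set g | r *+ 2 + `|b h| < `|b g|].
  by apply: large; rewrite ger0_real// addr_ge0// mulrn_wge0.
suff /(lt_le_trans rh) : `|b h| <= r *+ 2 by rewrite ltxx.
apply: (norm_cocycle_le (Q := b @` C) PF).
- exact: cvg_within.
- by apply: continuous_compact => //; exact: continuous_subspaceT.
- apply: (filterS _ (withinT _ _)) => g /= gr.
  exists (h ^ g)%g => //; apply: contrapT => /Clarge /(_ (normN g h Nh)) /=.
  apply/negP; rewrite -real_leNgt ?normr_real//; last first.
    by rewrite ger0_real// addr_ge0// mulrn_wge0.
  apply: le_trans (norm_cocycle_conjg _ _) _.
  by rewrite lerD2r lerMn2r.
- exact: withinT.
Qed.

(** When [g] and [h] commute, [h ^ g = h], so that the compact set in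
[norm_cocycle_le] is a single point. *)
Lemma bounded_along_of_commute (M N : set G) :
  (forall x y, M x -> N y -> commute x y) -> ~ proper_along M ->
  exists r : K, forall h, N h -> `|b h| <= r.
Proof.
move=> comMN /not_cvg_pinftyP[r PF]; exists (r *+ 2) => h Nh.
apply: (norm_cocycle_le (Q := [set b h]) PF).
- exact: cvg_trans (cvg_within _) (cvg_within _).
- exact: compact_set1.
- have Mg : \forall g \near within [set g | `|b g| <= r]
      (within M (at_infinity G)), M g by apply: cvg_within; exact: withinT.
  apply: filterS Mg => g Mg /=.
  by rewrite conjgE -(comMN g h Mg Nh) mulgA mulVg mul1g.
- exact: withinT.
Qed.

End C0Cocycles.

(** * Restriction to a closed subgroup *)

Section Restriction.
Variables (G : topologicalGroupType) (N : subgroup G).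

(** The inclusion of a closed subgroup is a proper map: the trace of a compact
set is compact. This is what makes the restriction of a C_0 representation
C_0. *)
Lemma set_val_at_infinity :
  closed N -> set_val n @[n --> at_infinity (set_type N)] `=>` at_infinity G.
Proof.
move=> clN P [C cC CP]; exists (set_val @^-1` C : set (set_type N)); last first.
  by move=> n; exact: CP.
move=> F PF FC.
have cCN : compact (C `&` subgroup_set N) by exact: compact_closedI.
have [|x [[Cx Nx] clx]] := cCN (set_val @ F) _.
  by apply: (@filterS _ F _ _ _ _ FC) => n Cn; split=> //; exact: (set_valP n).
exists (exist _ x (mem_set Nx)); split=> // A B FA [B' [[U Uop UB'] B'x B'B]].
have [_ [[n An <-] Un]] : set_val @` A `&` U !=set0.
  apply: clx; first by apply: (@filterS _ F _ _ _ _ FA) => n An; exists n.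
  by apply: open_nbhs_nbhs; split=> //; move: B'x; rewrite -UB'.
by exists n; split=> //; apply: B'B; rewrite -UB'.
Qed.

(** A compact subset of the subgroup is compact in the group, so that properness
of an action of the subgroup gives properness along it in the group. *)
Lemma within_at_infinity_set_val (A : set G) :
  (\forall n \near at_infinity (set_type N), A (set_val n)) ->
  \forall g \near within (subgroup_set N) (at_infinity G), A g.
Proof.
move=> [C cC CA]; exists (set_val @` C).
  apply: continuous_compact => //; apply: continuous_subspaceT.
  exact: initial_continuous.
move=> g nCg Ng; apply: (CA (exist _ g (mem_set Ng))) => Cg.
by apply: nCg; eexists; first exact: Cg.
Qed.

Variables (K : numFieldType) (V : completeNormedModType K).
Variables (pi : G -> {linear V -> V}).
Let piN (n : set_type N) := pi (set_val n).

Lemma isometric_representation_restrict :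
  isometric_representation pi -> isometric_representation piN.
Proof.
move=> [[pi1 piM] isom cont]; split=> [|n v|v].
- by split=> [v|g h v]; [exact: pi1|exact: piM].
- exact: isom.
- move=> n; apply: (@continuous_comp _ G _ (set_val : set_type N -> G)
    (fun g => pi g v)).
    exact: initial_continuous.
  exact: cont.
Qed.

Lemma C0_representation_restrict :
  closed N -> C0_representation pi -> C0_representation piN.
Proof.
move=> clN c0 L Lcont v.
apply: cvg_trans (c0 L Lcont v).
exact: (cvg_app (fun g => L (pi g v)) (set_val_at_infinity clN)).
Qed.

Lemma affine_action_restrict (alpha : G -> V -> V) :
  affine_action pi alpha ->
  affine_action piN (fun n : set_type N => alpha (set_val n)).
Proof.
move=> [[a1 aM] ac [b aE]]; split.
- by split=> [v|g h v]; [exact: a1|exact: aM].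
- move=> z.
  apply: (@continuous_comp _ (G * V)%type _
    (fun y : set_type N * V => (set_val y.1, y.2)) (fun y => alpha y.1 y.2)).
    apply: cvg_pair; last exact: cvg_snd.
    apply: (@continuous_comp _ _ _ fst (set_val : set_type N -> G)).
      exact: cvg_fst.
    exact: initial_continuous.
  exact: ac.
- by exists (fun n => b (set_val n)) => n v; exact: aE.
Qed.

End Restriction.

(** * The two assertions *)

Section Property.
Variables (R : realType) (k : scalar_kind).
Local Notation K := (scalars R k).
Variables (G : topologicalGroupType) (V : completeNormedModType K).

Lemma property_BP0_of_commuting (M N : subgroup G) :
  closed M -> closed N -> normal_subgroup M -> normal_subgroup N ->
  ~ compact M -> ~ compact N -> centralize_each_other M N ->
  property_BP0 G V.
Proof.
move=> clM clN nM nN ncM ncN comMN pi ipi c0 alpha affalpha.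
have [b [alphaE bcoc bcont]] := affine_action_cocycle affalpha.
have [Mproper|Mnproper] := pselect (proper_along b (subgroup_set M)).
  right; apply/(proper_actionP ipi alphaE).
  exact: (proper_of_proper_along ipi c0 bcoc bcont clM ncM nM Mproper).
left; apply/(has_bounded_orbitP ipi alphaE).
have [r br] := bounded_along_of_commute ipi c0 bcoc comMN Mnproper.
exists (r *+ 2).
exact: (bounded_of_bounded_along ipi c0 bcoc clN ncN nN br).
Qed.

Lemma property_BP0_of_normal_subgroup (N : subgroup G) :
  closed N -> normal_subgroup N -> ~ compact N -> property_BP0 N V ->
  property_BP0 G V.
Proof.
move=> clN nN ncN BPN pi ipi c0 alpha affalpha.
have [b [alphaE bcoc bcont]] := affine_action_cocycle affalpha.
have ipiN := isometric_representation_restrict N ipi.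
have alphaNE (n : set_type N) v :
  alpha (set_val n) v = pi (set_val n) v + b (set_val n) by exact: alphaE.
have [] := BPN _ ipiN (C0_representation_restrict clN c0) _
  (affine_action_restrict N affalpha).
  move=> /(has_bounded_orbitP ipiN alphaNE)[r br]; left.
  apply/(has_bounded_orbitP ipi alphaE); exists (r *+ 2).
  apply: (bounded_of_bounded_along ipi c0 bcoc clN ncN nN) => h Nh.
  exact: (br (exist _ h (mem_set Nh))).
move=> /(proper_actionP ipiN alphaNE) bNproper; right.
apply/(proper_actionP ipi alphaE).
apply: (proper_of_proper_along ipi c0 bcoc bcont clN ncN nN) => P Pinfty.
exact: (within_at_infinity_set_val (bNproper P Pinfty)).
Qed.

End Property.

Theorem proposition1p3 (R : realType) (k : scalar_kind)
    (G : topologicalGroupType) (V : completeNormedModType (scalars R k)) :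
  locally_compact_group G ->
  ((exists M N : subgroup G,
      [/\ closed M /\ closed N,
          normal_subgroup M /\ normal_subgroup N,
          ~ compact M /\ ~ compact N &
          centralize_each_other M N]) ->
    property_BP0 G V) /\
  ((exists N : subgroup G,
      [/\ closed N, normal_subgroup N, ~ compact N & property_BP0 N V]) ->
    property_BP0 G V).
Proof.
move=> _; split.
  move=> [M [N [[clM clN] [nM nN] [ncM ncN] comMN]]].
  exact: (property_BP0_of_commuting clM clN nM nN ncM ncN comMN).
move=> [N [clN nN ncN BPN]].
exact: (property_BP0_of_normal_subgroup clN nN ncN BPN).
Qed.
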